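(* Let $q$ be a prime power. Let $t\ge 0$ and $r,v,k,\ell>0$ be integers, and put $s:=\gcd(q-1,v)$, $d:=(q-1)/s$, and $d_0:=d/\gcd(d,\ell-1)$. Suppose that $q=q_0^m$, where $q_0$ is a prime power, $m$ is an even positive integer and $q_0\equiv -1\pmod{d}$. Let $\hat h\in\mathbb{F}_{q_0}[x]$ and let $h(x):= h_k(x)^t\, \hat h(h_{\ell}(x)^{d_0})$. Then $f(x):=x^r h(x^v)$ permutes $\mathbb{F}_q$ if and only if $\gcd(r,s)=1$, $\gcd(2r+(k-1)tv,2d)=2$, and $h$ has no roots in $\mu_d$.
   Context: For a positive integer $k$, $h_k(x):=x^{k-1}+x^{k-2}+\dots+1$ (so $h_1=1$). For a positive integer $n$, $\mu_n$ denotes the set of all $n$-th roots of unity in a fixed algebraic closure of $\mathbb{F}_q$, i.e. all $z$ with $z^n=1$. A polynomial over $\mathbb{F}_q$ permutes $\mathbb{F}_q$ if the induced map $\mathbb{F}_q\to\mathbb{F}_q$ is a bijection. Here $\mathbb{F}_{q_0}$ is viewed as a subfield of $\mathbb{F}_q$, and $\gcd(d,0)=d$. *)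

(* Defs.v *)
From mathcomp Require Export all_boot all_order all_algebra all_field.

Set Implicit Arguments.
Unset Strict Implicit.
Unset Printing Implicit Defensive.

Import GRing.Theory.
Local Open Scope ring_scope.

Definition hpoly (R : nzRingType) (k : nat) : {poly R} := \sum_(i < k) 'X^i.

Definition permutes (F : finFieldType) (f : {poly F}) : Prop :=
  bijective (fun a : F => f.[a]).

(* Closedness of K is carried by its type; only algebraicity over F is asked. *)
Definition is_algebraic_closure (F : fieldType) (K : closedFieldType)
    (iota : {rmorphism F -> K}) : Prop :=
  forall z : K, algebraicOver iota z.

Definition no_roots_in_mu (F : fieldType) (K : closedFieldType)
    (iota : {rmorphism F -> K}) (h : {poly F}) (n : nat) : Prop :=
  forall z : K, n.-unity_root z -> ~~ root (map_poly iota h) z.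

(* Main.v *)
Require Import Defs.
From mathcomp Require Import all_boot all_order all_algebra all_field.
From mathcomp Require Import all_fingroup all_solvable zify.

Set Implicit Arguments.
Unset Strict Implicit.
Unset Printing Implicit Defensive.

Import GRing.Theory.
Local Open Scope ring_scope.

(** Why the theorem holds.  Write [s * d = q - 1], where [s] divides [v].  If
    [h] vanishes at some [w] in mu_d, then [w = x ^+ v] for a nonzero [x], so
    [f] sends both [0] and [x] to [0]; hence a permutation polynomial [f]
    forces [h] to have no roots in mu_d, and this may be assumed throughout.

    The map [x |-> x ^+ s] sends the nonzero elements onto mu_d, and there
    [f(x) ^+ s] turns out to be a power of [x ^+ s].  Indeed, let [w] be in
    mu_d.  Since [d] divides [q0 + 1], [w ^+ q0 = w^-1], so applying the
    [q0]-Frobenius to [h_k(w)] evaluates the self-reciprocal polynomial [h_k]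
    at [w^-1] and gives [h_k(w) ^+ q0 * w ^+ (k - 1) = h_k(w)]
    ([hpoly_expf_card]).  The exponent [d0] makes the factor
    [w ^+ ((l - 1) * d0)] trivial, so [h_l(w) ^+ d0] and therefore the value of
    [hhat] lie in the field with [q0] elements.  Because [m] is even,
    [s = (q0 - 1) * N] for an integer [N], and raising to the power [s]
    eliminates [hhat] and leaves [h(w) ^+ s * w ^+ ((k - 1) * t * N) = 1]
    ([horner_hpoly_comp_power]).  With [w = x ^+ v] this reads
    [f(x) ^+ s = (x ^+ s) ^+ A], where [2 * A = 2 * r + (k - 1) * t * v].

    The classical criterion ([permutes_power_criterion]) now says that [f]
    permutes exactly when [gcd(r, s) = 1] and [gcd(A, d) = 1], and the latter
    is [gcd(2 * A, 2 * d) = 2].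

    For [A] to be an integer, and for the exponents to match modulo [q - 1] and
    not only modulo [(q - 1) / 2], a parity condition is required
    ([hpoly_nonroot_parity]): [(k - 1) * t * ((q0 + 1) / d)] must be even.  If
    it were odd, then [-1] would lie in mu_d and would be a root of [h_k]. *)

(** * Powers in a finite field *)

Lemma expf_card_pred (F : finFieldType) (x : F) :
  x != 0 -> x ^+ #|F|.-1 = 1.
Proof.
move=> x_neq0; have q_gt1 := finNzRing_gt1 F.
by apply: (mulfI x_neq0); rewrite -exprS mulr1 (ltn_predK q_gt1) expf_card.
Qed.

Lemma finField_prim_root (F : finFieldType) :
  exists g : F, (#|F|.-1).-primitive_root g.
Proof.
have q_gt1 : (1 < #|F|)%N := finNzRing_gt1 F.
pose rs := enum (predC1 (0 : F)).
have q1_gt0 : (0 < #|F|.-1)%N by rewrite -ltnS (ltn_predK q_gt1).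
have [|||g _ prim_g] := hasP (@has_prim_root F #|F|.-1 rs q1_gt0 _ _ _).
- apply/allP=> x; rewrite mem_enum inE => x_neq0.
  by apply/unity_rootP/expf_card_pred.
- exact: enum_uniq.
- by rewrite -cardE cardC1.
by exists g.
Qed.

(** In the cyclic group of nonzero elements, of order [n], the image of the
    [v]-th power map is the subgroup of order [n / gcd(n, v)]: by Bezout,
    [g ^+ gcd(n, v)] is a [v]-th power of a power of [g]. *)
Lemma finField_powerP (F : finFieldType) (v : nat) (a : F) :
  a ^+ (#|F|.-1 %/ gcdn #|F|.-1 v) = 1 -> exists2 x : F, x != 0 & a = x ^+ v.
Proof.
have [g prim_g] := finField_prim_root F.
set n := #|F|.-1; set s := gcdn n v => a_unity.
have n_gt0 : (0 < n)%N := prim_order_gt0 prim_g.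
have s_gt0 : (0 < s)%N by rewrite gcdn_gt0 n_gt0.
have nE : (n %/ s * s)%N = n by rewrite divnK // dvdn_gcdl.
have g_neq0 : g != 0 by rewrite (prim_root_eq0 prim_g) -lt0n.
have a_n : a ^+ n = 1 by rewrite -nE exprM a_unity expr1n.
have [[i _] /= aE] := prim_rootP prim_g a_n.
have /dvdnP[j iE] : (s %| i)%N.
  have d_gt0 : (0 < n %/ s)%N by rewrite divn_gt0 // dvdn_leq // dvdn_gcdl.
  rewrite -(dvdn_pmul2r d_gt0) mulnC nE (prim_order_dvd prim_g).
  by rewrite exprM -aE a_unity.
have [b _] := Bezoutl v n_gt0.
rewrite (prim_order_dvd prim_g) -/s exprD => /eqP gE.
exists (((g ^+ b)^-1) ^+ j); first by rewrite expf_neq0 // invr_neq0 // expf_neq0.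
have gs : g ^+ s = ((g ^+ b)^-1) ^+ v.
  by rewrite exprVn -exprM; apply: (divr1_eq); rewrite invrK.
by rewrite aE iE mulnC exprM gs -!exprM mulnC.
Qed.

Lemma expr_gcd1 (F : fieldType) (x : F) (m n : nat) :
  (0 < m)%N -> x ^+ m = 1 -> x ^+ n = 1 -> x ^+ gcdn m n = 1.
Proof.
move=> m_gt0 xm xn; have [b _ /dvdnP[c e]] := Bezoutl n m_gt0.
have := congr1 (fun i => x ^+ i) e.
by rewrite exprD mulnC exprM xn expr1n mulr1 mulnC exprM xm expr1n.
Qed.

(** Raising to the power [s] maps the nonzero elements onto mu_d with kernel
    mu_s, and [f(x) = x ^+ r * H(x ^+ v)] covers the power map
    [z |-> z ^+ A] of mu_d.  So [f] is bijective when [z ^+ A] is bijective on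
    mu_d and [f] is injective on each coset of mu_s; on such a coset
    [H(x ^+ v)] is a nonzero constant, so only [x ^+ r] matters. *)
Lemma permutes_power_criterion (F : finFieldType) (r s d v A : nat)
    (H : {poly F}) :
  (0 < r)%N -> (s * d)%N = #|F|.-1 -> (s %| v)%N ->
  (forall x, x != 0 -> H.[x ^+ v] != 0) ->
  (forall x, x != 0 -> (x ^+ r * H.[x ^+ v]) ^+ s = x ^+ (s * A)) ->
  permutes ('X^r * (H \Po 'X^v)) <-> coprime r s /\ coprime A d.
Proof.
move=> r_gt0 sd /dvdnP[e vE] H_neq0 fs.
have fE x : ('X^r * (H \Po 'X^v)).[x] = x ^+ r * H.[x ^+ v].
  by rewrite hornerM horner_comp !hornerXn.
have [g prim_g] := finField_prim_root F.
have n_gt0 := prim_order_gt0 prim_g; rewrite -sd in prim_g n_gt0.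
have [s_gt0 d_gt0] : (0 < s)%N /\ (0 < d)%N by lia.
have g_neq0 : g != 0 by rewrite (prim_root_eq0 prim_g) -lt0n.
split=> [f_bij | [co_rs co_Ad]].
- split.
  + (* A root of unity of order gcd(r, s) has the same image as 1. *)
    have p_gt0 : (0 < gcdn r s)%N by rewrite gcdn_gt0 r_gt0.
    have [s' sE] := dvdnP (dvdn_gcdr r s).
    set p := gcdn r s in p_gt0 sE *; rewrite /coprime -/p.
    have zp : (g ^+ (s' * d)) ^+ p = 1.
      by rewrite -exprM mulnAC -sE (prim_expr_order prim_g).
    have z_dvd i : (p %| i)%N -> (g ^+ (s' * d)) ^+ i = 1.
      by case/dvdnP=> j ->; rewrite [(j * p)%N]mulnC exprM zp expr1n.
    have p_dvd_v : (p %| v)%N by rewrite vE dvdn_mull // dvdn_gcdr.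
    have : g ^+ (s' * d) = 1.
      apply: (bij_inj f_bij); rewrite !fE !expr1n !z_dvd //.
      exact: dvdn_gcdl.
    move/eqP; rewrite -(prim_order_dvd prim_g) {1}sE -mulnA.
    have s'_gt0 : (0 < s')%N by move: s_gt0; rewrite sE; case: (s').
    by rewrite dvdn_pmul2l // -{2}[d]mul1n dvdn_pmul2r // dvdn1.
  + (* If x is the preimage of a generator g, then g ^+ s = x ^+ (s * A), and
       the left-hand side has order d while the order of the right-hand side
       divides d / gcd(A, d). *)
    have [f1 _ f1K] := f_bij.
    have := f1K g; rewrite fE; set x := f1 g => fx.
    have x_neq0 : x != 0.
      by apply: contraNneq g_neq0 => x0; rewrite -fx x0 expr0n gtn_eqF // mul0r.
    have gs := fs x x_neq0; rewrite fx in gs.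
    have p_gt0 : (0 < gcdn A d)%N by rewrite gcdn_gt0 d_gt0 orbT.
    have [A' AE] := dvdnP (dvdn_gcdl A d).
    have [d' dE] := dvdnP (dvdn_gcdr A d).
    set p := gcdn A d in p_gt0 AE dE *; rewrite /coprime -/p.
    have : g ^+ (s * d') = 1.
      rewrite exprM gs -exprM AE.
      have -> : (s * (A' * p) * d' = s * d * A')%N by rewrite dE; lia.
      by rewrite exprM sd expf_card_pred // expr1n.
    move/eqP; rewrite -(prim_order_dvd prim_g) dvdn_pmul2l // dE.
    have d'_gt0 : (0 < d')%N by move: d_gt0; rewrite dE; case: (d').
    by rewrite -{2}[d']muln1 dvdn_pmul2l // dvdn1.
- apply: injF_bij => x y; rewrite !fE.
  have f0 z : (z ^+ r * H.[z ^+ v] == 0) = (z == 0).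
    have [->|z_neq0] := eqVneq z 0.
      by rewrite expr0n gtn_eqF // mul0r eqxx.
    by rewrite mulf_eq0 expf_eq0 (negPf z_neq0) andbF (negPf (H_neq0 z _)).
  have [-> /eqP|x_neq0] := eqVneq x 0.
    by rewrite expr0n gtn_eqF // mul0r eq_sym f0 => /eqP->.
  have [-> /eqP|y_neq0] := eqVneq y 0.
    by rewrite expr0n gtn_eqF // mul0r f0 => /eqP.
  (* The quotient of two points with the same image is killed by s * A and by
     s * d, hence by s, and then by r. *)
  move=> fxy.
  pose u := x / y; have u_neq0 : u != 0 by rewrite mulf_neq0 ?invr_eq0.
  have u_eq1 i : x ^+ i = y ^+ i -> u ^+ i = 1.
    by move=> xyi; rewrite expr_div_n xyi divff ?expf_neq0.
  have us : u ^+ s = 1.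
    rewrite -[u ^+ s]expr1 -(eqP co_Ad) gcdnC; apply: expr_gcd1 => //.
    + by rewrite -exprM sd expf_card_pred.
    + by rewrite -exprM; apply: u_eq1; rewrite -!fs // fxy.
  have xyv : x ^+ v = y ^+ v.
    by apply: divr1_eq; rewrite -expr_div_n -/u vE mulnC exprM us expr1n.
  have ur : u ^+ r = 1.
    by apply/u_eq1/(mulIf (H_neq0 y y_neq0)); rewrite -{1}xyv.
  by apply: divr1_eq; rewrite -/u -[u]expr1 -(eqP co_rs); apply: expr_gcd1.
Qed.

(** * Roots of unity in the closure *)

(** The elements of [F] are already all the roots of ['X^#|F| - 'X] in [K]. *)
Lemma unity_root_finField (F : finFieldType) (K : fieldType)
    (jota : {rmorphism F -> K}) (n : nat) (z : K) :
  (n %| #|F|.-1)%N -> z ^+ n = 1 -> exists a : F, z = jota a.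
Proof.
move=> /dvdnP[c nE] zn.
have q_gt1 := finNzRing_gt1 F.
have : root (map_poly jota ('X^#|F| - 'X)) z.
  rewrite rmorphB /= map_polyXn map_polyX rootE !hornerE.
  by rewrite -(ltn_predK q_gt1) exprS nE mulnC exprM zn expr1n mulr1 subrr.
rewrite finField_genPoly rmorph_prod /= rootE horner_prod.
case/prodf_eq0=> a _; rewrite rmorphB /= map_polyX map_polyC !hornerE subr_eq0.
by move/eqP; exists a.
Qed.

Lemma no_roots_in_muP (F : finFieldType) (K : closedFieldType)
    (jota : {rmorphism F -> K}) (h : {poly F}) (n : nat) :
  (0 < n)%N -> (n %| #|F|.-1)%N ->
  no_roots_in_mu jota h n <-> (forall w : F, w ^+ n = 1 -> h.[w] != 0).
Proof.
move=> n_gt0 n_dvd; split=> [no_root w wn | no_root z].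
- have := no_root (jota w).
  rewrite /root horner_map fmorph_eq0; apply.
  by apply/unity_rootP; rewrite -rmorphXn wn rmorph1.
- move/unity_rootP => zn; have [a zE] := unity_root_finField jota n_dvd zn.
  rewrite zE /root horner_map fmorph_eq0; apply: no_root.
  by apply: (fmorph_inj jota); rewrite rmorphXn rmorph1 -zE.
Qed.

(** * The Frobenius map and the polynomials [hpoly] *)

(** The cardinal of a subfield is a power of the characteristic. *)
Lemma exprD_card (F0 F : finFieldType) (iota : {rmorphism F0 -> F}) (a b : F) :
  (a + b) ^+ #|F0| = a ^+ #|F0| + b ^+ #|F0|.
Proof.
apply: exprDn_pchar; have [p p_pr pchar_p] := finPcharP F0.
have /abelem_pgroup := fin_ring_pchar_abelem pchar_p.
rewrite /pgroup cardsT; apply: sub_in_pnat => p' _ /eqP->.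
exact: rmorph_pchar pchar_p.
Qed.

(** The [#|F0|]-Frobenius of [F] fixes the coefficients, since these come
    from [F0]. *)
Lemma horner_map_card (F0 F : finFieldType) (iota : {rmorphism F0 -> F})
    (p : {poly F0}) (a : F) :
  (map_poly iota p).[a] ^+ #|F0| = (map_poly iota p).[a ^+ #|F0|].
Proof.
elim/poly_ind: p => [|p c IHp].
  by rewrite rmorph0 !horner0 expr0n gtn_eqF // ltnW ?finNzRing_gt1.
rewrite rmorphD rmorphM /= map_polyX map_polyC /= !hornerE.
by rewrite (exprD_card iota) exprMn IHp -rmorphXn expf_card.
Qed.

Lemma horner_hpoly (R : nzRingType) (k : nat) (x : R) :
  (hpoly R k).[x] = \sum_(i < k) x ^+ i.
Proof. by rewrite horner_sum; apply: eq_bigr => i _; rewrite hornerXn. Qed.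

Lemma map_hpoly (R S : nzRingType) (f : {rmorphism R -> S}) (k : nat) :
  map_poly f (hpoly R k) = hpoly S k.
Proof. by rewrite rmorph_sum; apply: eq_bigr => i _; rewrite /= map_polyXn. Qed.

Lemma hpoly_reciprocal (F : fieldType) (k : nat) (x : F) :
  x != 0 -> (hpoly F k).[x^-1] * x ^+ (k - 1) = (hpoly F k).[x].
Proof.
move=> x_neq0; rewrite !horner_hpoly mulr_suml (reindex_inj rev_ord_inj) /=.
apply: eq_bigr => i _; have lt_ik := ltn_ord i.
have -> : (k - 1 = (k - i.+1) + i)%N by lia.
by rewrite exprD exprVn mulKf // expf_neq0.
Qed.

(** Consecutive terms of the sum cancel, in every characteristic. *)
Lemma hpoly_even_N1 (R : nzRingType) (k : nat) :
  ~~ odd k -> (hpoly R k).[-1] = 0.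
Proof.
move=> k_even; rewrite horner_hpoly -(even_halfK k_even).
elim: k./2 => [|j IHj]; first by rewrite big_ord0.
rewrite doubleS !big_ord_recr /= IHj add0r exprS -signr_odd odd_double.
by rewrite mulr1 subrr.
Qed.

(** Covers both parities of [#|F0|]: when it is even, [-1 = 1]. *)
Lemma expfN1_card (F0 F : finFieldType) (iota : {rmorphism F0 -> F}) :
  (-1 : F) ^+ #|F0| = -1.
Proof. by rewrite -(rmorphN1 iota) -rmorphXn expf_card. Qed.

(** If [k] is even, then [-1] is a root of [h_k].  If [c] is odd, then [-1]
    lies in mu_d: [(-1) ^+ (d * c)] is [(-1) * (-1) ^+ #|F0| = 1] and depends
    only on the parity of [d]. *)
Lemma hpoly_nonroot_parity (F0 F : finFieldType) (iota : {rmorphism F0 -> F})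
    (k t c d : nat) :
  #|F0|.+1 = (d * c)%N ->
  (forall w : F, w ^+ d = 1 -> (hpoly F k).[w] ^+ t != 0) ->
  ~~ odd ((k - 1) * t * c).
Proof.
move=> q0E no_root; apply/negP; rewrite !oddM => /andP[/andP[k1_odd t_odd] c_odd].
have N1d : (-1 : F) ^+ d = 1.
  have := expfN1_card iota; move/(congr1 ( *%R (-1))).
  rewrite -exprS q0E mulrNN mulr1 -signr_odd oddM c_odd andbT.
  by rewrite signr_odd.
have k_even : ~~ odd k by case: (k) k1_odd => // k'; rewrite subn1 /= => ->.
have := no_root _ N1d; rewrite hpoly_even_N1 // expf_eq0 eqxx andbT -eqn0Ngt.
by case: (t) t_odd.
Qed.

(** Frobenius inverts [w], and [h_k] is self-reciprocal with coefficients in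
    the prime field. *)
Lemma hpoly_expf_card (F0 F : finFieldType) (iota : {rmorphism F0 -> F})
    (k : nat) (w : F) :
  w ^+ #|F0|.+1 = 1 ->
  (hpoly F k).[w] ^+ #|F0| * w ^+ (k - 1) = (hpoly F k).[w].
Proof.
move=> w_unity.
have w_neq0 : w != 0.
  by apply: contra_eq_neq w_unity => ->; rewrite expr0n /= eq_sym oner_neq0.
have wV : w ^+ #|F0| = w^-1.
  by apply: (mulfI w_neq0); rewrite -exprS w_unity divff.
by rewrite -(map_hpoly iota) horner_map_card wV map_hpoly hpoly_reciprocal.
Qed.

(** The value [y] of [hhat] is fixed by Frobenius, so
    [y ^+ (#|F0| - 1) = 1]; the value of [h_k] satisfies
    [h_k(w) ^+ (#|F0| - 1) = w ^- (k - 1)].  The identity is written as a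
    product equal to [1] to keep the exponent of [w] natural. *)
Lemma horner_hpoly_comp_power (F0 F : finFieldType) (iota : {rmorphism F0 -> F})
    (hhat : {poly F0}) (t k l d0 N : nat) (w : F) :
  let h := hpoly F k ^+ t * (map_poly iota hhat \Po (hpoly F l ^+ d0)) in
  w ^+ #|F0|.+1 = 1 -> w ^+ ((l - 1) * d0) = 1 -> h.[w] != 0 ->
  h.[w] ^+ (#|F0|.-1 * N) * w ^+ ((k - 1) * t * N) = 1.
Proof.
move=> h w_unity w_l; rewrite /h hornerM horner_exp horner_comp horner_exp.
set y := _.[_ ^+ d0]; set u := (hpoly F k).[w] ^+ t => uy_neq0.
have [u_neq0 y_neq0] : u != 0 /\ y != 0.
  by apply/andP; rewrite -negb_or -mulf_eq0.
have q0_gt1 := finNzRing_gt1 F0.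
have y_card : y ^+ #|F0| = y.
  rewrite /y horner_map_card; congr _.[_].
  rewrite -exprM mulnC exprM -{2}(hpoly_expf_card iota l w_unity).
  by rewrite exprMn -!exprM w_l mulr1.
have u_card : u ^+ #|F0| * w ^+ ((k - 1) * t) = u.
  by rewrite /u exprM -exprM mulnC exprM -exprMn hpoly_expf_card.
have y_pred : y ^+ #|F0|.-1 = 1.
  by apply: (mulfI y_neq0); rewrite -exprS (ltn_predK q0_gt1) mulr1.
have u_pred : u ^+ #|F0|.-1 * w ^+ ((k - 1) * t) = 1.
  by apply: (mulfI u_neq0); rewrite mulrA -exprS (ltn_predK q0_gt1) mulr1.
rewrite exprM (exprM w _ N) -exprMn [(u * y) ^+ _]exprMn y_pred mulr1 u_pred.
exact: expr1n.
Qed.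

(** * The permutation criterion *)

Theorem theorem1p3
  (q q0 m t r v k l : nat)
  (Fq Fq0 : finFieldType) (cardFq : #|Fq| = q) (cardFq0 : #|Fq0| = q0)
  (iota : {rmorphism Fq0 -> Fq})
  (K : closedFieldType) (jota : {rmorphism Fq -> K})
  (K_closure : is_algebraic_closure jota)
  (r_gt0 : (0 < r)%N) (v_gt0 : (0 < v)%N) (k_gt0 : (0 < k)%N)
  (l_gt0 : (0 < l)%N) (m_gt0 : (0 < m)%N) (m_even : ~~ odd m)
  (q_eq : q = (q0 ^ m)%N)
  (hhat : {poly Fq0}) :
  let s := gcdn (q - 1) v in
  let d := ((q - 1) %/ s)%N in
  let d0 := (d %/ gcdn d (l - 1))%N in
  let h : {poly Fq} :=
    hpoly Fq k ^+ t * (map_poly iota hhat \Po (hpoly Fq l ^+ d0)) in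
  let f : {poly Fq} := 'X^r * (h \Po 'X^v) in
  (q0%:Z = -1 %[mod d%:Z])%Z ->
  (permutes f <->
   [/\ gcdn r s = 1%N,
       gcdn (2 * r + (k - 1) * t * v) (2 * d) = 2%N
     & no_roots_in_mu jota h d]).
Proof.
move=> s d d0 h f q0_mod.
have q_gt1 : (1 < q)%N by rewrite -cardFq finNzRing_gt1.
have q0_gt1 : (1 < q0)%N by rewrite -cardFq0 finNzRing_gt1.
have nE : (q - 1 = #|Fq|.-1)%N by rewrite cardFq subn1.
have s_gt0 : (0 < s)%N by rewrite gcdn_gt0 v_gt0 orbT.
have sd : (s * d = #|Fq|.-1)%N by rewrite mulnC -nE divnK ?dvdn_gcdl.
have [_ d_gt0] : (0 < s)%N /\ (0 < d)%N.
  by apply/andP; rewrite -muln_gt0 sd cardFq -ltnS (ltn_predK q_gt1).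
have s_dvd_v : (s %| v)%N := dvdn_gcdr _ _.
have [e vE] := dvdnP s_dvd_v.
have [c q0E] : exists c, (q0.+1 = d * c)%N.
  move/eqP: q0_mod; rewrite eqz_mod_dvd opprK => d_dvd.
  have /dvdnP[c ->] : (d %| q0.+1)%N by rewrite -addn1.
  by exists c; rewrite mulnC.
(* q0 ^ m - 1 is a multiple of q0 ^ 2 - 1 because m is even. *)
have [M sE] : exists M, (s = q0.-1 * (c * M))%N.
  have [M ME] : exists M, ((q0 ^ m).-1 = q0.-1 * q0.+1 * M)%N.
    have -> : (q0.-1 * q0.+1 = (q0 ^ 2).-1)%N.
      by rewrite -[RHS]subn1 -{2}(exp1n 2) subn_sqr subn1 addn1.
    exists (\sum_(i < m./2) (q0 ^ 2) ^ i)%N.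
    by rewrite -predn_exp -expnM mul2n even_halfK.
  exists M; apply/eqP; rewrite -(eqn_pmul2r d_gt0) sd cardFq q_eq ME q0E.
  by apply/eqP; lia.
have no_rootP : no_roots_in_mu jota h d <-> (forall w, w ^+ d = 1 -> h.[w] != 0).
  by apply: no_roots_in_muP => //; rewrite -sd dvdn_mull.
have permutes_no_root : permutes f -> no_roots_in_mu jota h d.
  move=> f_bij; apply/no_rootP => w wd; apply/negP => /eqP hw.
  have [|x x_neq0 wE] := @finField_powerP Fq v w; first by rewrite -nE.
  case/eqP: x_neq0; apply: (bij_inj f_bij).
  rewrite /f !hornerM !horner_comp !hornerXn -wE hw mulr0.
  by rewrite expr0n gtn_eqF // mul0r.
suff criterion : no_roots_in_mu jota h d -> (permutes f <->
    coprime r s /\ gcdn (2 * r + (k - 1) * t * v) (2 * d) = 2%N).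
  split=> [f_bij | [co_rs co_d /criterion[_]]]; last by apply; split=> //; apply/eqP.
  have no_root := permutes_no_root f_bij.
  by have [/(_ f_bij)[/eqP]] := criterion no_root.
move/no_rootP => h_neq0.
have ktc_even : ~~ odd ((k - 1) * t * c).
  apply: (@hpoly_nonroot_parity _ _ iota k t c d); first by rewrite cardFq0.
  move=> w /h_neq0; rewrite hornerM horner_exp.
  by apply: contra => /eqP->; rewrite mul0r.
pose P := ((k - 1) * t * c)./2.
have PE : ((k - 1) * t * c = P * 2)%N by rewrite muln2 even_halfK.
(* B is half of (k - 1) * t * v, as v = e * s contains the factor c. *)
pose B := (P * e * q0.-1 * M)%N.
have BE : ((k - 1) * t * v = 2 * B)%N.
  rewrite vE sE /B.
  transitivity ((k - 1) * t * c * (e * q0.-1 * M))%N; first by lia.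
  by rewrite PE; lia.
have xv_mu (x : Fq) : x != 0 -> (x ^+ v) ^+ d = 1.
  by move=> x_neq0; rewrite vE -exprM -mulnA sd mulnC exprM expf_card_pred ?expr1n.
have f_power (x : Fq) : x != 0 -> (x ^+ r * h.[x ^+ v]) ^+ s = x ^+ (s * (r + B)).
  move=> x_neq0; set w := x ^+ v; have w_d : w ^+ d = 1 := xv_mu x x_neq0.
  have w_q0 : w ^+ #|Fq0|.+1 = 1 by rewrite cardFq0 q0E exprM w_d expr1n.
  have w_l : w ^+ ((l - 1) * d0) = 1.
    rewrite /d0 muln_divA ?dvdn_gcdl // mulnC -muln_divA ?dvdn_gcdr //.
    by rewrite exprM w_d expr1n.
  have := horner_hpoly_comp_power (c * M) w_q0 w_l (h_neq0 w w_d).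
  rewrite cardFq0 -sE -/h => h_power.
  have w_B : x ^+ (s * B) * w ^+ ((k - 1) * t * (c * M)) = 1.
    rewrite -exprM -exprD.
    (* The total exponent is P * e * M * s * (q0 + 1), a multiple of
       s * d = q - 1. *)
    have -> : (s * B + v * ((k - 1) * t * (c * M)) = s * d * (P * e * c * M))%N.
      have -> : ((k - 1) * t * (c * M) = P * 2 * M)%N by rewrite -PE mulnA.
      have q0_pred : (q0.-1 + 2 = d * c)%N by rewrite -q0E addn2 prednK // ltnW.
      transitivity (s * (P * e * M) * (q0.-1 + 2))%N; first by rewrite vE /B; lia.
      by rewrite q0_pred; lia.
    by rewrite exprM sd expf_card_pred // expr1n.
  have wN_neq0 : w ^+ ((k - 1) * t * (c * M)) != 0 by rewrite !expf_neq0.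
  rewrite exprMn mulnDr exprD -exprM [(r * s)%N]mulnC; congr (_ * _).
  by apply: (mulIf wN_neq0); rewrite h_power w_B.
have gcdE : gcdn (2 * r + (k - 1) * t * v) (2 * d) = (2 * gcdn (r + B) d)%N.
  by rewrite BE -mulnDr -muln_gcdr.
have [f_co co_f] := permutes_power_criterion r_gt0 sd s_dvd_v
  (fun x x_neq0 => h_neq0 _ (xv_mu x x_neq0)) f_power.
rewrite gcdE; split=> [/f_co[co_rs /eqP->] // | [co_rs co_d]].
by apply: co_f; split=> //; rewrite /coprime -(eqn_pmul2l (isT : (0 < 2)%N)) co_d.
Qed.
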